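(* Let $(X,A)$ and $(Y,B)$ be closed pairs of metrizable spaces and suppose that $h\colon X\setminus A\to Y\setminus B$ is a homeomorphism such that $h$ is an $A$-$B$-approaching map and $h^{-1}$ is a $B$-$A$-approaching map. If $H$ is a homology theory (resp. cohomology theory) on closed pairs of metrizable spaces satisfying the map excision axiom, then $H_*(X,A)\simeq H_*(Y,B)$ (resp. $H^*(X,A)\simeq H^*(Y,B)$).
   Context: A closed pair of metrizable spaces is a pair $(X,A)$, where $X$ is metrizable and $A$ is closed in $X$. If $A\subset X$ and $B\subset Y$ are closed subsets of metrizable spaces, a continuous map $f\colon X\setminus A\to Y\setminus B$ is $A$-$B$-approaching if it sends every sequence of points of $X\setminus A$ having a cluster point in $A$ to a sequence having a cluster point in $B$. A (co)homology theory on closed pairs of metrizable spaces is a sequence of covariant (contravariant) functors $H_n$ (resp. $H^n$), $n\in\mathbb Z$, from closed pairs of metrizable spaces and continuous maps of pairs to abelian groups, with natural (co)boundary homomorphisms, satisfying the Eilenberg–Steenrod homotopy, exactness and excision axioms (the dimension axiom is not required). Map excision axiom: every closed map $f\colon(X,A)\to(Y,B)$ of closed pairs that restricts to a homeomorphism between $X\setminus A$ and $Y\setminus B$ induces for each $n$ an isomorphism $H_n(X,A)\simeq H_n(Y,B)$ (resp. $H^n(X,A)\simeq H^n(Y,B)$). *)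

(* Defs.v *)
From HB Require Import structures.
From mathcomp Require Import all_boot all_order all_algebra.
From mathcomp Require Import all_classical reals topology.

Set Implicit Arguments.
Unset Strict Implicit.
Unset Printing Implicit Defensive.

Import Order.TTheory GRing.Theory Num.Theory.
Import numFieldTopology.Exports.

Local Open Scope classical_set_scope.
Local Open Scope ring_scope.

(* A subset [A : set X] used as a type is [set_type A], which carries the
   subspace topology; [set_val] is its inclusion into [X].  The type
   [subspace A] of the library is something else and is not used. *)

Definition metrizable (R : realType) (X : topologicalType) : Prop :=
  exists d : X -> X -> R,
    [/\ forall x, d x x = 0,
        forall x y, d x y = 0 -> x = y,
        forall x y, d x y = d y x,
        forall x y z, d x z <= d x y + d y z
      & forall x (U : set X), nbhs x U <->
          exists2 e : R, 0 < e & [set y | d x y < e] `<=` U].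

Record homeomorphism (X Y : topologicalType) := Homeomorphism {
  homeo_fun :> X -> Y ;
  homeo_inv : Y -> X ;
  homeo_funK : cancel homeo_fun homeo_inv ;
  homeo_invK : cancel homeo_inv homeo_fun ;
  homeo_fun_continuous : continuous homeo_fun ;
  homeo_inv_continuous : continuous homeo_inv }.

Definition approaching (X Y : topologicalType) (A : set X) (B : set Y)
    (f : set_type (~` A) -> set_type (~` B)) : Prop :=
  forall u : nat -> set_type (~` A),
    (exists2 a, A a & cluster ((fun n => set_val (u n)) @ \oo) a) ->
    exists2 b, B b & cluster ((fun n => set_val (f (u n))) @ \oo) b.

Record closed_pair (R : realType) := ClosedPair {
  cp_space :> topologicalType ;
  cp_sub : set cp_space ;
  cp_metrizable : metrizable R cp_space ;
  cp_closed : closed cp_sub }.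

Record pair_map (R : realType) (P Q : closed_pair R) := PairMap {
  pm_fun :> P -> Q ;
  pm_continuous : continuous pm_fun ;
  pm_sub : forall x, cp_sub x -> cp_sub (pm_fun x) }.

Definition id_pm (R : realType) (P : closed_pair R) : pair_map P P :=
  @PairMap R P P (fun x => x) (fun x => cvg_id) (fun _ Ax => Ax).

Lemma comp_pm_continuous (R : realType) (P Q S : closed_pair R)
  (g : pair_map Q S) (f : pair_map P Q) : continuous (fun x => g (f x)).
Proof.
by move=> x; apply: (@continuous_comp P Q S); exact: pm_continuous.
Qed.

Definition comp_pm (R : realType) (P Q S : closed_pair R)
    (g : pair_map Q S) (f : pair_map P Q) : pair_map P S :=
  @PairMap R P S (fun x => g (f x)) (@comp_pm_continuous R P Q S g f)
    (fun _ Ax => pm_sub g (pm_sub f Ax)).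

Lemma set_val_continuous (X : topologicalType) (C : set X) :
  continuous (set_val : set_type C -> X).
Proof. exact: initial_continuous. Qed.

Lemma continuous_set_type (X Y : topologicalType) (C : set Y)
  (f : X -> set_type C) :
  continuous (fun x => set_val (f x)) -> continuous f.
Proof. by move=> fc; apply/continuous_comp_initial. Qed.

Lemma metrizable_set_type (R : realType) (X : topologicalType) (C : set X) :
  metrizable R X -> metrizable R (set_type C).
Proof.
move=> [d [d0 dP dC dT dB]].
exists (fun x y => d (set_val x) (set_val y)); split => //.
- by move=> x y /dP; exact: val_inj.
- move=> x U; split.
  + move=> [_ [[V oV <-] Vx VU]].
    have /dB[e e0 eV] : nbhs (set_val x) V by exact: open_nbhs_nbhs.
    by exists e => // y /= /eV Vy; exact: VU.
  + move=> [e e0 eU].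
    have nx : nbhs (set_val x) [set y | d (set_val x) y < e].
      by apply/dB; exists e.
    exact: filterS eU (set_val_continuous nx).
Qed.

(* (X, empty) *)
Definition absolute (R : realType) (X : topologicalType)
    (mX : metrizable R X) : closed_pair R :=
  @ClosedPair R X set0 mX closed0.

Definition cp_total (R : realType) (P : closed_pair R) : closed_pair R :=
  absolute (cp_metrizable P).

(* For P = (X, A), this is (A, empty). *)
Definition cp_base (R : realType) (P : closed_pair R) : closed_pair R :=
  absolute (@metrizable_set_type R P (@cp_sub R P) (cp_metrizable P)).

Definition incl_base (R : realType) (P : closed_pair R) :
    pair_map (cp_base P) (cp_total P) :=
  @PairMap R (cp_base P) (cp_total P) set_val
    (@set_val_continuous P (@cp_sub R P)) (fun _ (F : False) => F).

Definition incl_total (R : realType) (P : closed_pair R) :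
    pair_map (cp_total P) P :=
  @PairMap R (cp_total P) P (fun x => x) (fun x => cvg_id)
    (fun _ (F : False) => False_ind _ F).

Definition restr_fun (R : realType) (P Q : closed_pair R) (f : pair_map P Q)
    (a : set_type (@cp_sub R P)) : set_type (@cp_sub R Q) :=
  exist _ (f (set_val a)) (mem_set (pm_sub f (set_valP a))).

Lemma restr_fun_continuous (R : realType) (P Q : closed_pair R)
  (f : pair_map P Q) : continuous (restr_fun f).
Proof.
apply: continuous_set_type => a /=.
apply: (@continuous_comp _ P Q); first exact: set_val_continuous.
exact: pm_continuous.
Qed.

Definition restr_base (R : realType) (P Q : closed_pair R)
    (f : pair_map P Q) : pair_map (cp_base P) (cp_base Q) :=
  @PairMap R (cp_base P) (cp_base Q) (restr_fun f)
    (@restr_fun_continuous R P Q f) (fun _ (F : False) => F).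

Lemma closed_set_val_preimage (X : topologicalType) (C A : set X) :
  closed A -> closed ((set_val : set_type C -> X) @^-1` A).
Proof. by move=> cA; apply: preimage_closed cA => x _; exact: set_val_continuous. Qed.

(* For P = (X, A), this is (X \ U, A \ U). *)
Definition cp_excise (R : realType) (P : closed_pair R) (U : set P) :
    closed_pair R :=
  @ClosedPair R (set_type (~` U)) (set_val @^-1` @cp_sub R P)
    (@metrizable_set_type R P (~` U) (cp_metrizable P))
    (@closed_set_val_preimage P (~` U) (@cp_sub R P) (@cp_closed R P)).

Definition incl_excise (R : realType) (P : closed_pair R) (U : set P) :
    pair_map (cp_excise U) P :=
  @PairMap R (cp_excise U) P set_val (@set_val_continuous P (~` U))
    (fun _ Ax => Ax).

(* Homotopy through maps of pairs. *)
Definition pair_homotopic (R : realType) (P Q : closed_pair R)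
    (f g : pair_map P Q) : Prop :=
  exists F : P * set_type (`[0, 1]%classic : set R) -> Q,
    [/\ continuous F,
        forall x t, set_val t = 0 -> F (x, t) = f x,
        forall x t, set_val t = 1 -> F (x, t) = g x
      & forall x t, cp_sub x -> cp_sub (F (x, t))].

Definition exact_at (U V W : zmodType) (f : U -> V) (g : V -> W) : Prop :=
  range f = [set v | g v = 0].

(* The long exact sequence of (X, A) is
   H_n(A) -> H_n(X) -> H_n(X, A) -> H_(n-1)(A) -> H_(n-1)(X). *)
Record homology_theory (R : realType) := HomologyTheory {
  hom_grp :> int -> closed_pair R -> zmodType ;
  hom_map : forall (n : int) (P Q : closed_pair R),
    pair_map P Q -> {additive hom_grp n P -> hom_grp n Q} ;
  hom_bd : forall (n : int) (P : closed_pair R),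
    {additive hom_grp n P -> hom_grp (n - 1) (cp_base P)} ;
  hom_map_id : forall n P (x : hom_grp n P), hom_map n (id_pm P) x = x ;
  hom_map_comp : forall n P Q S (g : pair_map Q S) (f : pair_map P Q)
    (x : hom_grp n P),
    hom_map n (comp_pm g f) x = hom_map n g (hom_map n f x) ;
  hom_bd_natural : forall n P Q (f : pair_map P Q) (x : hom_grp n P),
    hom_bd n Q (hom_map n f x) = hom_map (n - 1) (restr_base f) (hom_bd n P x) ;
  hom_homotopy : forall n P Q (f g : pair_map P Q),
    pair_homotopic f g -> hom_map n f =1 hom_map n g ;
  hom_exact_total : forall n P,
    exact_at (hom_map n (incl_base P)) (hom_map n (incl_total P)) ;
  hom_exact_pair : forall n P,
    exact_at (hom_map n (incl_total P)) (hom_bd n P) ;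
  hom_exact_base : forall n P,
    exact_at (hom_bd n P) (hom_map (n - 1) (incl_base P)) ;
  hom_excision : forall n (P : closed_pair R) (U : set P),
    open U -> closure U `<=` interior (@cp_sub R P) ->
    bijective (hom_map n (incl_excise U)) }.

(* The long exact sequence of (X, A) is
   H^n(X, A) -> H^n(X) -> H^n(A) -> H^(n+1)(X, A) -> H^(n+1)(X). *)
Record cohomology_theory (R : realType) := CohomologyTheory {
  coh_grp :> int -> closed_pair R -> zmodType ;
  coh_map : forall (n : int) (P Q : closed_pair R),
    pair_map P Q -> {additive coh_grp n Q -> coh_grp n P} ;
  coh_bd : forall (n : int) (P : closed_pair R),
    {additive coh_grp n (cp_base P) -> coh_grp (n + 1) P} ;
  coh_map_id : forall n P (x : coh_grp n P), coh_map n (id_pm P) x = x ;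
  coh_map_comp : forall n P Q S (g : pair_map Q S) (f : pair_map P Q)
    (x : coh_grp n S),
    coh_map n (comp_pm g f) x = coh_map n f (coh_map n g x) ;
  coh_bd_natural : forall n P Q (f : pair_map P Q)
    (x : coh_grp n (cp_base Q)),
    coh_map (n + 1) f (coh_bd n Q x) = coh_bd n P (coh_map n (restr_base f) x) ;
  coh_homotopy : forall n P Q (f g : pair_map P Q),
    pair_homotopic f g -> coh_map n f =1 coh_map n g ;
  coh_exact_total : forall n P,
    exact_at (coh_map n (incl_total P)) (coh_map n (incl_base P)) ;
  coh_exact_base : forall n P,
    exact_at (coh_map n (incl_base P)) (coh_bd n P) ;
  coh_exact_pair : forall n P,
    exact_at (coh_bd n P) (coh_map (n + 1) (incl_total P)) ;
  coh_excision : forall n (P : closed_pair R) (U : set P),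
    open U -> closure U `<=` interior (@cp_sub R P) ->
    bijective (coh_map n (incl_excise U)) }.

Definition closed_map (X Y : topologicalType) (f : X -> Y) : Prop :=
  forall C : set X, closed C -> closed (f @` C).

Definition restricts_to_homeomorphism (R : realType) (P Q : closed_pair R)
    (f : pair_map P Q) : Prop :=
  exists g : homeomorphism (set_type (~` @cp_sub R P))
                           (set_type (~` @cp_sub R Q)),
    forall x, set_val (g x) = f (set_val x).

Definition hom_map_excision (R : realType) (H : homology_theory R) : Prop :=
  forall (P Q : closed_pair R) (f : pair_map P Q),
    closed_map f -> restricts_to_homeomorphism f ->
    forall n, bijective (hom_map H n f).

Definition coh_map_excision (R : realType) (H : cohomology_theory R) : Prop :=
  forall (P Q : closed_pair R) (f : pair_map P Q),
    closed_map f -> restricts_to_homeomorphism f ->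
    forall n, bijective (coh_map H n f).

Definition zmod_isomorphic (U V : zmodType) : Prop :=
  exists f : {additive U -> V}, bijective f.

(* Main.v *)
(** The closure [Z] in [X * Y] of the graph of [h] meets the complement of
    [A `*` B] exactly in that graph, by continuity of [h] and of its inverse.
    Let [C] be the part of [Z] over [A] (equivalently, over [B]).  The
    projection [Z -> X] is a homeomorphism off [C], and it is closed because
    [h] is approaching: if points of [Z] project to points tending to [x], then
    nearby points of the graph have second coordinates with a cluster point.
    Likewise for [Z -> Y], so map excision applied to the two projections gives
    H(X, A) = H(Z, C) = H(Y, B). *)

Require Import Defs.
From HB Require Import structures.
From mathcomp Require Import all_boot all_order all_algebra.
From mathcomp Require Import all_classical reals topology.
From mathcomp Require Import interval_inference num_normedtype lra.

Import Order.TTheory GRing.Theory Num.Theory.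

Local Open Scope classical_set_scope.
Local Open Scope ring_scope.

(** * Isomorphism of abelian groups *)

Lemma zmod_isomorphic_sym (U V : zmodType) :
  zmod_isomorphic U V -> zmod_isomorphic V U.
Proof.
move=> [f [g fK gK]].
have g_add : zmod_morphism g by exact: can2_zmod_morphism fK gK.
pose g' : {additive V -> U} :=
  HB.pack g (GRing.isZmodMorphism.Build V U g g_add).
by exists g'; exists f.
Qed.

Lemma zmod_isomorphic_trans (U V W : zmodType) :
  zmod_isomorphic U V -> zmod_isomorphic V W -> zmod_isomorphic U W.
Proof.
move=> [f fbij] [g gbij]; exists (g \o f : {additive U -> W}).
exact: bij_comp.
Qed.

(** * Cluster points, subspaces and metrics *)

Lemma lim_cluster (T : topologicalType) (F : set_system T) (x : T) :
  ProperFilter F -> F --> x -> cluster F x.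
Proof. by move=> FF Fx U V FU /Fx FV; exact: filter_ex (filterI FU FV). Qed.

Lemma set_val_setC (T : Type) (C : set T) (t : set_type (~` C)) :
  ~ C (set_val t).
Proof. exact: (set_valP t). Qed.

Lemma set_val_comp_continuous (T X : topologicalType) (C : set X)
  (f : T -> set_type C) : continuous f -> continuous (fun t => set_val (f t)).
Proof.
move=> fc t; apply: (@continuous_comp T (set_type C) X); first exact: fc.
exact: set_val_continuous.
Qed.

(** The matrix of [metrizable], named so that one chosen metric can be fixed throughout. *)
Definition metrizes {R : realType} {X : topologicalType} (d : X -> X -> R) :=
  [/\ forall x, d x x = 0,
      forall x y, d x y = 0 -> x = y,
      forall x y, d x y = d y x,
      forall x y z, d x z <= d x y + d y z
    & forall x (U : set X), nbhs x U <->
        exists2 e : R, 0 < e & [set y | d x y < e] `<=` U].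

Section Metrizes.
Context {R : realType} {X : topologicalType} {d : X -> X -> R}.
Hypothesis dX : metrizes d.

Lemma metrizes_ball x {e} : 0 < e -> nbhs x [set y | d x y < e].
Proof. by case: dX => _ _ _ _ dB e0; apply/dB; exists e. Qed.

Lemma metrizes_continuous_ball (T : topologicalType) (f : T -> X) t e :
  continuous f -> 0 < e -> nbhs t [set t' | d (f t) (f t') < e].
Proof. by move=> fc e0; exact: fc (metrizes_ball _ e0). Qed.

Lemma metrizes_ge0 x y : 0 <= d x y.
Proof.
case: dX => d0 _ dC dT _; have := dT x y x.
by rewrite d0 (dC y x); lra.
Qed.

Lemma metrizes_eq x y : (forall e : R, 0 < e -> d x y < e) -> x = y.
Proof.
case: dX => _ dP _ _ _ xy; apply: dP; apply/eqP.
have := metrizes_ge0 x y; rewrite le_eqVlt => /orP[/eqP<- //|/xy].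
by rewrite ltxx.
Qed.

(** The centre [x] is kept apart from [set_val a], so that [erefl] also serves when [a] is a lift of
    [x] to [C]. *)
Lemma metrizes_ball_sub {x} {C : set X} {U : set (set_type C)} {a} :
  set_val a = x -> nbhs a U ->
  exists2 e : R, 0 < e & forall b, d x (set_val b) < e -> U b.
Proof.
move=> ax [V [[W oW <-] Wa VU]].
case: dX => _ _ _ _ dB.
have /dB[e e0 eW] : nbhs x W by apply: open_nbhs_nbhs; rewrite -ax.
by exists e => // b /eW Wb; apply: VU.
Qed.

End Metrizes.

(** * The closure of the graph *)

Section GraphClosure.
Context {R : realType} {X Y : topologicalType}.
Context {dX : X -> X -> R} {dY : Y -> Y -> R}.
Hypotheses (mdX : metrizes dX) (mdY : metrizes dY).
Context {A : set X} {B : set Y}.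

(** Membership of [(x, y)] in the closure of the graph of [h], written with the two metrics so that
    exchanging the factors is immediate. *)
Definition near_graph (h : set_type (~` A) -> set_type (~` B))
    (x : X) (y : Y) : Prop :=
  forall e : R, 0 < e ->
    exists a, dX x (set_val a) < e /\ dY y (set_val (h a)) < e.

(** Graph points close to [(a, y)] have first coordinate close to [a], hence by continuity second
    coordinate close to [h a]; it is also close to [y]. *)
Lemma near_graph_over (h : set_type (~` A) -> set_type (~` B)) a y :
  continuous h -> near_graph h (set_val a) y -> y = set_val (h a).
Proof.
move=> hc ay; case: (mdY) => _ _ dYC dYT _.
apply: (metrizes_eq mdY) => e e0; have e2 : 0 < e / 2 by lra.
have : nbhs a [set a' | dY (set_val (h a)) (set_val (h a')) < e / 2].
  apply: (metrizes_continuous_ball mdY) => //.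
  exact: set_val_comp_continuous.
move=> /(metrizes_ball_sub mdX erefl)[r r0 hr].
have [a' []] : exists a', dX (set_val a) (set_val a') < Num.min r (e / 2) /\
    dY y (set_val (h a')) < Num.min r (e / 2).
  by apply: ay; rewrite lt_min r0.
rewrite !lt_min => /andP[/hr /= ha _] /andP[_ ya].
have := dYT y (set_val (h a')) (set_val (h a)).
rewrite (dYC (set_val (h a'))); lra.
Qed.

End GraphClosure.

Lemma near_graph_sym {R : realType} {X Y : topologicalType}
  {dX : X -> X -> R} {dY : Y -> Y -> R} {A : set X} {B : set Y}
  (h : homeomorphism (set_type (~` A)) (set_type (~` B))) x y :
  near_graph (dX := dX) (dY := dY) h x y <->
  near_graph (dX := dY) (dY := dX) (homeo_inv h) y x.
Proof.
split=> xy e /xy[].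
- by move=> a [xa ya]; exists (h a); rewrite homeo_funK.
- by move=> b [yb xb]; exists (homeo_inv h b); rewrite homeo_invK.
Qed.

(* [p] and [q] are the projections of the closure [Z] of the graph of [h]; they
   are kept abstract so that the results apply to both projections. *)
Section Projection.
Context {R : realType} {X Y Z : topologicalType}.
Context {dX : X -> X -> R} {dY : Y -> Y -> R}.
Hypotheses (mdX : metrizes dX) (mdY : metrizes dY).
Context {A : set X} {B : set Y} {h : set_type (~` A) -> set_type (~` B)}.
Hypotheses (h_continuous : continuous h) (h_approaching : approaching h).
Context {p : Z -> X} {q : Z -> Y}.
(** Together with [pq_inj] below, these two hypotheses identify [Z] with the closure of the graph in
    its subspace topology. *)
Hypothesis pq_range : forall x y,
  (exists z, p z = x /\ q z = y) <-> near_graph (dX := dX) (dY := dY) h x y.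
Hypothesis pq_nbhs : forall z (U : set Z), nbhs z U <->
  exists2 e : R, 0 < e &
    forall w, dX (p z) (p w) < e -> dY (q z) (q w) < e -> U w.

Let dXC : forall x y, dX x y = dX y x. Proof. by case: mdX. Qed.
Let dYC : forall x y, dY x y = dY y x. Proof. by case: mdY. Qed.
Let dXT : forall x y z, dX x z <= dX x y + dX y z. Proof. by case: mdX. Qed.
Let dYT : forall x y z, dY x z <= dY x y + dY y z. Proof. by case: mdY. Qed.

Lemma proj_continuous : continuous p.
Proof.
move=> z U; case: (mdX) => _ _ _ _ dB /dB[e e0 eU].
by apply/pq_nbhs; exists e => // w pw _; apply: eU.
Qed.

Lemma proj_over z a : p z = set_val a -> q z = set_val (h a).
Proof.
move=> pz; apply: near_graph_over => //; first exact: mdX.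
  exact: mdY.
by apply/pq_range; exists z.
Qed.


(** The bound makes [u] converge to [x]. If [x] lies in [A], the approaching property gives [y];
    otherwise [h] is continuous at [x] and [y] is its value there. *)
Lemma graph_cluster (u : nat -> set_type (~` A)) x :
  (forall n, dX x (set_val (u n)) < n.+1%:R^-1) ->
  exists y, cluster ((fun n => set_val (h (u n))) @ \oo) y.
Proof.
move=> ux; have ux_cvg : (fun n => set_val (u n)) @ \oo --> x.
  case: (mdX) => _ _ _ _ dB; move=> U /dB[e e0 eU].
  have [N _ HN] := near_infty_natSinv_lt (PosNum e0).
  exists N => // n /HN /= ne; apply: eU => /=; exact: lt_trans (ux n) ne.
have [Ax|nAx] := pselect (A x).
  have [|y _ yu] := h_approaching u; last by exists y.
  exists x => //; exact: lim_cluster.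
pose a : set_type (~` A) := exist _ x (mem_set nAx).
exists (set_val (h a)); apply: lim_cluster.
have ua : u @ \oo --> a.
  move=> U /(metrizes_ball_sub mdX erefl)[e e0 eU].
  apply: (filterS (F := \oo) (fun n => eU (u n))).
  exact: (ux_cvg _ (metrizes_ball mdX x e0)).
exact: (cvg_comp _ _ ua (set_val_comp_continuous _ _ _ _ h_continuous a)).
Qed.

(** The approaching property speaks only of sequences off [A], so the points [v n] of [D] are
    shadowed by graph points over [u n]. A cluster point [y] of their second coordinates supplies
    the missing coordinate of a point of [D] over [x]. *)
Lemma proj_closed : closed_map p.
Proof.
move=> D cD x xD.
have appr e : 0 < e -> exists a : set_type (~` A), exists z, [/\ D z,
    dX x (set_val a) < e, dX (p z) (set_val a) < e
    & dY (q z) (set_val (h a)) < e].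
  move=> e0; have e2 : 0 < e / 2 by lra.
  have [_ [[z Dz <-] /= xz]] := xD _ (metrizes_ball mdX x e2).
  have /pq_range/(_ _ e2)[a [za ya]] : exists w, p w = p z /\ q w = q z.
    by exists z.
  exists a, z; have := dXT x (p z) (set_val a).
  by move=> xa; split=> //; lra.
have inv_gt0 n : 0 < n.+1%:R^-1 :> R by rewrite invr_gt0.
have [u /choice[v uv]] := choice (fun n => appr _ (inv_gt0 n)).
have [y yu] : exists y, cluster ((fun n => set_val (h (u n))) @ \oo) y.
  by apply: (graph_cluster u x) => n; have [] := uv n.
(* At a single index both the graph point and the point of [D] are close to [(x, y)]: the former
   puts [(x, y)] in the range of the projections, the latter in the closure of [D]. *)
have close e : 0 < e -> exists n, [/\ D (v n), dX x (set_val (u n)) < e,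
    dY y (set_val (h (u n))) < e, dX x (p (v n)) < e & dY y (q (v n)) < e].
  move=> e0; have e2 : 0 < e / 2 by lra.
  have [N _ HN] := near_infty_natSinv_lt (PosNum e2).
  (* Clustering against the image of a tail forces an index [n >= N], where the error [n.+1%:R^-1]
     is below [e / 2]. *)
  have tail : ((fun n => set_val (h (u n))) @ \oo)
      [set set_val (h (u n)) | n in [set n | (N <= n)%N]].
    by exists N => // n /= Nn; exists n.
  have [_ [[n /= Nn <-] /= yn]] := yu _ _ tail (metrizes_ball mdY y e2).
  have [Dv] := uv n; move: (HN n Nn) => /=.
  move: n.+1%:R^-1 => r re xu zu yv.
  exists n; split=> //; try lra.
    have := dXT x (set_val (u n)) (p (v n)); rewrite (dXC (set_val _)); lra.
  have := dYT y (set_val (h (u n))) (q (v n)); rewrite (dYC (set_val _)); lra.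
have [z [pz qz]] : exists z, p z = x /\ q z = y.
  by apply/pq_range => e /close[n [_ xu yu' _ _]]; exists (u n).
exists z => //; apply: cD => U /pq_nbhs[e /close[n [Dv _ _ xv yv]] eU].
by exists (v n); split=> //; apply: eU; rewrite ?pz ?qz.
Qed.

Context {C : set Z}.
Hypothesis C_preimage : forall z, C z <-> A (p z).
Hypothesis pq_inj : forall z w, p z = p w -> q z = q w -> z = w.

(** Off [C] the inverse of [p] sends [a] to the point with coordinates [a] and [h a]; it is
    continuous because both coordinates are. *)
Lemma proj_homeomorphism :
  exists g : homeomorphism (set_type (~` C)) (set_type (~` A)),
    forall z, set_val (g z) = p (set_val z).
Proof.
have gA (z : set_type (~` C)) : (~` A) (p (set_val z)).
  by move=> /C_preimage; exact: set_val_setC.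
pose g z : set_type (~` A) := exist _ (p (set_val z)) (mem_set (gA z)).
have /choice[s ps] (a : set_type (~` A)) : exists z, p z = set_val a.
  have [|z [pz _]] := (pq_range (set_val a) (set_val (h a))).2.
    move=> e e0; exists a; by case: (mdX) => ->; case: (mdY) => ->.
  by exists z.
have qs a : q (s a) = set_val (h a) by apply: proj_over.
have sC a : (~` C) (s a).
  by move=> /C_preimage; rewrite ps; exact: set_val_setC.
pose k a : set_type (~` C) := exist _ (s a) (mem_set (sC a)).
have gK : cancel g k.
  move=> z; apply: val_inj => /=; apply: pq_inj; first by rewrite ps.
  by rewrite qs; symmetry; apply: proj_over.
have kK : cancel k g by move=> a; apply: val_inj; rewrite /= ps.
have gc : continuous g.
  apply: continuous_set_type => z /=.
  apply: (@continuous_comp _ Z X); first exact: set_val_continuous.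
  exact: proj_continuous.
have kc : continuous k.
  apply: continuous_set_type => a U /= /pq_nbhs[e e0 eU].
  have aX : nbhs a [set b | dX (set_val a) (set_val b) < e].
    by apply: (metrizes_continuous_ball mdX) => //; exact: set_val_continuous.
  have aY : nbhs a [set b | dY (set_val (h a)) (set_val (h b)) < e].
    apply: (metrizes_continuous_ball mdY) => //.
    exact: set_val_comp_continuous.
  apply: (filterS (F := nbhs a) _ (filterI aX aY)) => b /= [abX abY].
  by apply: eU; rewrite ?ps ?qs.
by exists (Homeomorphism gK kK gc kc).
Qed.

End Projection.

(** * The roof of two projections and the isomorphisms *)

Definition map_excisive {R : realType} {P Q : closed_pair R}
    (f : pair_map P Q) : Prop :=
  closed_map f /\ restricts_to_homeomorphism f.

(** This purely topological statement serves homology and cohomology alike. *)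
Lemma approaching_homeomorphism_roof (R : realType) (X Y : topologicalType)
  (mX : metrizable R X) (mY : metrizable R Y)
  (A : set X) (B : set Y) (cA : closed A) (cB : closed B)
  (h : homeomorphism (set_type (~` A)) (set_type (~` B))) :
  approaching (homeo_fun h) -> approaching (homeo_inv h) ->
  exists (P : closed_pair R) (f : pair_map P (ClosedPair mX cA))
    (g : pair_map P (ClosedPair mY cB)), map_excisive f /\ map_excisive g.
Proof.
move=> h_app hinv_app.
have [dX mdX] := mX; have [dY mdY] := mY.
pose G : set (X * Y) := [set z | near_graph (dX := dX) (dY := dY) h z.1 z.2].
pose p (z : set_type G) := (set_val z).1.
pose q (z : set_type G) := (set_val z).2.
have hc := @homeo_fun_continuous _ _ h.
have hinvc := @homeo_inv_continuous _ _ h.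
have pq_range x y : (exists z, p z = x /\ q z = y) <->
    near_graph (dX := dX) (dY := dY) h x y.
  split=> [[z [<- <-]]|xy]; first exact: (set_valP z).
  by exists (exist _ (x, y) (mem_set (xy : G (x, y)))).
have qp_range y x : (exists z, q z = y /\ p z = x) <->
    near_graph (dX := dY) (dY := dX) (homeo_inv h) y x.
  rewrite -near_graph_sym -pq_range.
  by split=> -[z [qz pz]]; exists z.
have pq_inj z w : p z = p w -> q z = q w -> z = w.
  move=> pzw qzw; apply: val_inj.
  rewrite [LHS](surjective_pairing (val z)) [RHS]surjective_pairing.
  by congr pair.
have pq_nbhs (z : set_type G) (U : set (set_type G)) : nbhs z U <->
    exists2 e : R, 0 < e &
      forall w, dX (p z) (p w) < e -> dY (q z) (q w) < e -> U w.
  split.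
    move=> [V [[W oW <-] Wz WU]].
    have [[V1 V2] [/= n1 n2] V12] : nbhs (set_val z) W by exact: open_nbhs_nbhs.
    case: (mdX) => _ _ _ _ dXB; have /dXB[e1 e10 e1V] := n1.
    case: (mdY) => _ _ _ _ dYB; have /dYB[e2 e20 e2V] := n2.
    exists (Num.min e1 e2); first by rewrite lt_min e10.
    move=> w; rewrite !lt_min => /andP[w1 _] /andP[_ w2].
    by apply: WU; apply: V12; split; [exact: e1V|exact: e2V].
  move=> [e e0 eU].
  have zU : nbhs (set_val z)
      ([set x | dX (p z) x < e] `*` [set y | dY (q z) y < e]).
    by exists ([set x | dX (p z) x < e], [set y | dY (q z) y < e]) => //;
      split; exact: metrizes_ball.
  apply: (filterS (F := nbhs z) _ (set_val_continuous zU)).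
  by move=> w [/= w1 w2]; exact: eU.
have qp_nbhs (z : set_type G) (U : set (set_type G)) : nbhs z U <->
    exists2 e : R, 0 < e &
      forall w, dY (q z) (q w) < e -> dX (p z) (p w) < e -> U w.
  by rewrite pq_nbhs; split=> -[e e0 eU]; exists e => // w ? ?; exact: eU.
have mG : metrizable R (set_type G).
  (* For the sum metric an [e]-ball lies in the [e]-box and contains the [e / 2]-box. *)
  exists (fun z w => dX (p z) (p w) + dY (q z) (q w)).
  case: (mdX) => dX0 dXP dXC dXT _; case: (mdY) => dY0 dYP dYC dYT _.
  split.
  - by move=> z; rewrite dX0 dY0 addr0.
  - move=> z w zw; have := metrizes_ge0 mdX (p z) (p w).
    have := metrizes_ge0 mdY (q z) (q w).
    by move=> qzw pzw; apply: pq_inj; [apply: dXP|apply: dYP]; lra.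
  - by move=> z w; rewrite dXC dYC.
  - move=> z w v; have := dXT (p z) (p w) (p v).
    by have := dYT (q z) (q w) (q v); lra.
  - move=> z U; rewrite pq_nbhs; split=> -[e e0 eU].
      exists e => // w /= zw; have := metrizes_ge0 mdX (p z) (p w).
      by have := metrizes_ge0 mdY (q z) (q w) => qzw pzw; apply: eU; lra.
    by exists (e / 2) => [|w zw zw']; [|apply: eU => /=]; lra.
have pc : continuous p by exact: (proj_continuous mdX pq_nbhs).
have qc : continuous q by exact: (proj_continuous mdY qp_nbhs).
(* If [q z] were outside [B], then [p z] would be its image under the inverse of [h], hence outside
   [A]; the converse uses [h] itself. *)
have AB z : A (p z) <-> B (q z).
  split=> [Az|Bz]; apply: contrapT => nz.
  - have pz := proj_over mdY mdX hinvc qp_range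
      z (exist _ (q z) (mem_set nz)) erefl.
    by rewrite pz in Az; exact: set_val_setC Az.
  - have qz := proj_over mdX mdY hc pq_range
      z (exist _ (p z) (mem_set nz)) erefl.
    by rewrite qz in Bz; exact: set_val_setC Bz.
have cC : closed (p @^-1` A) by apply: preimage_closed cA => z _; exact: pc.
pose P := ClosedPair mG cC.
exists P, (@PairMap R P (ClosedPair mX cA) p pc (fun _ Az => Az)).
exists (@PairMap R P (ClosedPair mY cB) q qc (fun z => (AB z).1)).
split; split.
- exact: (proj_closed mdX mdY hc h_app pq_range pq_nbhs).
- by apply: (proj_homeomorphism mdX mdY hc pq_range pq_nbhs).
- exact: (proj_closed mdY mdX hinvc hinv_app qp_range qp_nbhs).
- apply: (proj_homeomorphism mdY mdX hinvc qp_range qp_nbhs) => // z w qzw pzw.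
  exact: pq_inj.
Qed.

Theorem theorem5 (R : realType) (X Y : topologicalType)
    (mX : metrizable R X) (mY : metrizable R Y)
    (A : set X) (B : set Y) (cA : closed A) (cB : closed B)
    (h : homeomorphism (set_type (~` A)) (set_type (~` B)))
    (h_approaching : approaching (homeo_fun h))
    (hinv_approaching : approaching (homeo_inv h)) :
  (forall H : homology_theory R, hom_map_excision H ->
     forall n : int,
       zmod_isomorphic (H n (ClosedPair mX cA)) (H n (ClosedPair mY cB)))
  /\
  (forall H : cohomology_theory R, coh_map_excision H ->
     forall n : int,
       zmod_isomorphic (H n (ClosedPair mX cA)) (H n (ClosedPair mY cB))).
Proof.
have [P [f [g [[fc fh] [gc gh]]]]] :=
  approaching_homeomorphism_roof R X Y mX mY A B cA cB h
    h_approaching hinv_approaching.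
split=> H excision n; apply: (@zmod_isomorphic_trans _ (H n P)).
(* In homology the map of [f] must be inverted; in cohomology, by contravariance, that of [g]. *)
- by apply: zmod_isomorphic_sym; exists (hom_map H n f); exact: excision.
- by exists (hom_map H n g); exact: excision.
- by exists (coh_map H n f); exact: excision.
- by apply: zmod_isomorphic_sym; exists (coh_map H n g); exact: excision.
Qed.
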